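(* Let $\mathcal{P}=[\overline{a_1,\ldots , a_{k}}]$ be a purely periodic continued fraction with $a_1,\dots,a_k\in\mathbb{Z}[1/p]$. Then $\mathcal{P}$ is $p$-adically convergent if and only if the following conditions are satisfied: \begin{enumerate} \item[(i)] $|A_{k}+B_{k-1}|_p>1$; \item[(ii)] for $j=1,\ldots, k$, if $M(a_j,\dotsc , a_{j+k-1})_{21}=0$ then $|M(a_j,\dotsc , a_{j+k-1})_{22}|_p <1$. \end{enumerate}
   Context: $p$ is a fixed odd prime, $|\cdot|_p$ the $p$-adic absolute value. For a continued fraction $[c_1,c_2,\dots]$ define $A_0=1$, $A_1=c_1$, $A_n=A_{n-1}c_n+A_{n-2}$ and $B_0=0$, $B_1=1$, $B_n=B_{n-1}c_n+B_{n-2}$ for $n\ge 2$; the $n$-th convergent is the point $[A_n:B_n]\in\mathbb{P}^1$, and the continued fraction is $p$-adically convergent if these convergents converge in $\mathbb{P}^1(\mathbb{Q}_p)$. Here the partial quotients are the periodic sequence $a_1,\dots,a_k,a_1,a_2,\dots$ (indices taken modulo $k$, so $a_{j+k}=a_j$). For $c_1,\dots,c_n$, $M(c_1,\dots,c_n)=\prod_{i=1}^n\begin{pmatrix} c_i & 1\\ 1 & 0\end{pmatrix}=\begin{pmatrix} A_n & A_{n-1}\\ B_n & B_{n-1}\end{pmatrix}$ (computed for the continued fraction $[c_1,\dots,c_n]$), and $M(\cdot)_{21},M(\cdot)_{22}$ denote its $(2,1)$ and $(2,2)$ entries. In particular $A_k+B_{k-1}$ is the trace of $M(a_1,\dots,a_k)$.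 *)

(* Defs.v *)
From HB Require Import structures.
From mathcomp Require Import all_boot all_order all_algebra.
From mathcomp Require Import all_classical topology ring.

Set Implicit Arguments.
Unset Strict Implicit.
Unset Printing Implicit Defensive.
Import Order.TTheory GRing.Theory Num.Theory.
Local Open Scope classical_set_scope.
Local Open Scope ring_scope.
Local Open Scope quotient_scope.

Definition padic_val (p : nat) (x : rat) : int :=
  (logn p `|numq x|)%:Z - (logn p `|denq x|)%:Z.

(* Its values are powers of p, so it is taken with values in rat. *)
Definition padic_abs (p : nat) (x : rat) : rat :=
  if x == 0 then 0 else p%:R ^ (- padic_val p x).

Section PadicAbs.
Variable p : nat.
Local Notation abs := (padic_abs p).

Lemma padic_valE (m n : int) : m != 0 -> n != 0 ->
  padic_val p (m%:~R / n%:~R) = (logn p `|m|)%:Z - (logn p `|n|)%:Z.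
Proof.
move=> m0 n0; rewrite /padic_val; set x := m%:~R / n%:~R.
have x0 : x != 0 by rewrite mulf_neq0 ?invr_eq0 ?intr_eq0.
have /(congr1 absz) : numq x * n = m * denq x.
  apply: (@intr_inj rat); rewrite !rmorphM /= [X in X * _]numqE /x.
  by rewrite mulrAC divfK ?intr_eq0.
rewrite !abszM => /(congr1 (logn p)).
rewrite !lognM ?absz_gt0 ?numq_eq0 ?denq_neq0 // => E.
by apply/eqP; rewrite subr_eq addrAC eq_sym subr_eq -!PoszD -E.
Qed.

Lemma padic_abs0 : abs 0 = 0. Proof. by rewrite /padic_abs eqxx. Qed.

Lemma padic_val_nonprime x : ~~ prime p -> padic_val p x = 0.
Proof. by move=> np; rewrite /padic_val /logn (negPf np) subrr. Qed.

Lemma padic_expz_gt0 x : 0 < p%:R ^ (- padic_val p x) :> rat.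
Proof.
have [pp|/padic_val_nonprime ->] := boolP (prime p); last by rewrite oppr0 expr0z.
by rewrite exprz_gt0 // ltr0n prime_gt0.
Qed.

Lemma padic_abs_gt0 x : (0 < abs x) = (x != 0).
Proof.
by rewrite /padic_abs; case: (eqVneq x 0) => [_|_]; rewrite ?ltxx ?padic_expz_gt0.
Qed.

Lemma padic_abs_ge0 x : 0 <= abs x.
Proof. by rewrite /padic_abs; case: (eqVneq x 0) => // _; rewrite ltW ?padic_expz_gt0. Qed.

Lemma padic_abs_eq0 x : (abs x == 0) = (x == 0).
Proof. by apply: negb_inj; rewrite -[RHS]padic_abs_gt0 lt0r padic_abs_ge0 andbT. Qed.

Lemma padic_abs1 : abs 1 = 1.
Proof. by rewrite /padic_abs /padic_val oner_eq0 /= logn1 subrr oppr0 expr0z. Qed.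

Lemma padic_absN x : abs (- x) = abs x.
Proof. by rewrite /padic_abs oppr_eq0 /padic_val numqN denqN abszN. Qed.

Lemma padic_absB x y : abs (x - y) = abs (y - x).
Proof. by rewrite -padic_absN opprB. Qed.

Lemma padic_absM x y : abs (x * y) = abs x * abs y.
Proof.
have [->|x0] := eqVneq x 0; first by rewrite !(mul0r, padic_abs0).
have [->|y0] := eqVneq y 0; first by rewrite !(mulr0, padic_abs0).
rewrite /padic_abs mulf_eq0 (negPf x0) (negPf y0) /=.
have [pp|np] := boolP (prime p); last first.
  by rewrite !padic_val_nonprime // oppr0 expr0z mulr1.
have p0 : p%:R != 0 :> rat by rewrite pnatr_eq0 -lt0n prime_gt0.
rewrite -exprzDr ?unitfE //; congr (_ ^ _).
rewrite -opprD; congr (- _).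
have -> : x * y = (numq x * numq y)%:~R / (denq x * denq y)%:~R.
  by rewrite !rmorphM /= invfM mulrACA !divq_num_den.
rewrite padic_valE ?mulf_neq0 ?numq_eq0 ?denq_neq0 // !abszM.
rewrite !lognM ?absz_gt0 ?numq_eq0 ?denq_neq0 //.
by rewrite /padic_val !PoszD opprD addrACA.
Qed.

Lemma padic_absV x : abs x^-1 = (abs x)^-1.
Proof.
have [->|x0] := eqVneq x 0; first by rewrite invr0 padic_abs0.
apply: (@mulfI _ (abs x)); first by rewrite padic_abs_eq0.
by rewrite -padic_absM !mulfV ?padic_abs1 ?padic_abs_eq0.
Qed.

Lemma logn_absz_add (m n : int) : m + n != 0 -> m != 0 -> n != 0 ->
  (minn (logn p `|m|) (logn p `|n|) <= logn p `|(m + n)%R|)%N.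
Proof.
move=> mn0 m0 n0; have [pp|np] := boolP (prime p); last by rewrite /logn (negPf np).
rewrite -pfactor_dvdn ?absz_gt0 //; set k := minn _ _.
change ((p ^ k)%N%:Z %| m + n)%Z; rewrite rpredD //.
- by change (p ^ k %| `|m|)%N; rewrite pfactor_dvdn ?absz_gt0 // geq_minl.
- by change (p ^ k %| `|n|)%N; rewrite pfactor_dvdn ?absz_gt0 // geq_minr.
Qed.

Lemma padic_abs_ultra x y : abs (x + y) <= Num.max (abs x) (abs y).
Proof.
have [->|x0] := eqVneq x 0; first by rewrite add0r padic_abs0 le_max lexx orbT.
have [->|y0] := eqVneq y 0; first by rewrite addr0 padic_abs0 le_max lexx.
have [->|xy0] := eqVneq (x + y) 0; first by rewrite padic_abs0 le_max padic_abs_ge0.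
rewrite /padic_abs (negPf x0) (negPf y0) (negPf xy0).
have [pp|np] := boolP (prime p); last first.
  by rewrite !padic_val_nonprime // oppr0 expr0z maxxx.
have p1 : 1 <= p%:R :> rat by rewrite ler1n prime_gt0.
suff : (padic_val p x <= padic_val p (x + y)) || (padic_val p y <= padic_val p (x + y)).
  by case/orP => h; rewrite le_max; apply/orP; [left|right];
     apply: ler_weXz2l => //; rewrite lerN2.
pose d := denq x * denq y.
have d0 : d != 0 by rewrite mulf_neq0 ?denq_neq0.
pose m := numq x * denq y; pose n := numq y * denq x.
have m0 : m != 0 by rewrite mulf_neq0 ?denq_neq0 ?numq_eq0.
have n0 : n != 0 by rewrite mulf_neq0 ?denq_neq0 ?numq_eq0.
have Ex : x = m%:~R / d%:~R.
  by rewrite /m /d !rmorphM /= -mulf_div divq_num_den divff ?mulr1 // intr_eq0 denq_neq0.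
have Ey : y = n%:~R / d%:~R.
  rewrite /n /d [denq x * _]mulrC !rmorphM /= -mulf_div divq_num_den divff ?mulr1 //.
  by rewrite intr_eq0 denq_neq0.
have Exy : x + y = (m + n)%:~R / d%:~R by rewrite Ex Ey rmorphD mulrDl.
have mn0 : m + n != 0 by apply: contraNneq xy0 => E; rewrite Exy E mul0r.
rewrite Exy [X in padic_val p X <= _]Ex [X in _ || (padic_val p X <= _)]Ey !padic_valE // !lerD2r !lez_nat -geq_min.
exact: logn_absz_add.
Qed.

Lemma padic_abs_ultra_lt x y e : abs x < e -> abs y < e -> abs (x + y) < e.
Proof. by move=> xe ye; apply: le_lt_trans (padic_abs_ultra x y) _; rewrite gt_max xe. Qed.

Lemma padic_abs_dominant x y : abs y < abs x -> abs (x + y) = abs x.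
Proof.
move=> yx; apply/eqP; rewrite eq_le; apply/andP; split.
  by apply: le_trans (padic_abs_ultra _ _) _; rewrite ge_max lexx ltW.
have := padic_abs_ultra (x + y) (- y); rewrite addrK padic_absN le_max.
by case/orP => // /(lt_le_trans yx); rewrite ltxx.
Qed.

End PadicAbs.

Definition padic_cauchy (p : nat) (u : nat -> rat) : Prop :=
  forall e : rat, 0 < e -> exists N : nat, forall m n : nat,
    (N <= m)%N -> (N <= n)%N -> padic_abs p (u m - u n) < e.

Definition padic_null (p : nat) (u : nat -> rat) : Prop :=
  forall e : rat, 0 < e -> exists N : nat, forall n : nat,
    (N <= n)%N -> padic_abs p (u n) < e.

Definition padic_cauchyb (p : nat) : pred (nat -> rat) :=
  fun u => `[< padic_cauchy p u >].

Section CauchyRing.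
Variable p : nat.
Local Notation abs := (padic_abs p).

Lemma padic_cauchy_bounded u : padic_cauchy p u ->
  exists2 B : rat, 0 < B & forall n, abs (u n) < B.
Proof.
move=> /(_ 1 ltr01) [N cN].
pose B := 1 + \sum_(i < N.+1) abs (u i).
have leB (i : 'I_N.+1) : abs (u i) <= \sum_(i < N.+1) abs (u i).
  by rewrite (bigD1 i) //= lerDl sumr_ge0 // => *; exact: padic_abs_ge0.
have B0 : 0 < B by rewrite ltr_pwDl // sumr_ge0 // => *; exact: padic_abs_ge0.
exists B => // n; have [nN|Nn] := leqP n N.
  by apply: (le_lt_trans (leB (Ordinal (nN : n < N.+1)%N))); rewrite ltrDr.
rewrite -[u n](subrK (u N)); apply: padic_abs_ultra_lt.
  by apply: (lt_le_trans (cN n N _ _)) => //; [exact: ltnW|]; rewrite lerDl sumr_ge0 // => *; exact: padic_abs_ge0.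
by apply: (le_lt_trans (leB ord_max)); rewrite ltrDr.
Qed.

Lemma padic_cauchy_subring : subring_closed (padic_cauchyb p).
Proof.
split=> [|u v /asboolP cu /asboolP cv|u v /asboolP cu /asboolP cv]; apply/asboolP.
- by move=> e e0; exists 0%N => m n _ _; rewrite subrr padic_abs0.
- move=> e e0; have [M cM] := cu e e0; have [N cN] := cv e e0.
  exists (maxn M N) => m n; rewrite !geq_max => /andP[Mm Nm] /andP[Mn Nn].
  have -> : (u - v) m - (u - v) n = (u m - u n) + (v n - v m).
    by change (u m - v m - (u n - v n) = (u m - u n) + (v n - v m)); ring.
  by apply: padic_abs_ultra_lt; [exact: cM | exact: cN].
- have [A A0 uA] := padic_cauchy_bounded cu.
  have [B B0 vB] := padic_cauchy_bounded cv.
  move=> e e0; have [M cM] := cu (e / B) (divr_gt0 e0 B0).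
  have [N cN] := cv (e / A) (divr_gt0 e0 A0).
  exists (maxn M N) => m n; rewrite !geq_max => /andP[Mm Nm] /andP[Mn Nn].
  have -> : (u * v) m - (u * v) n = (u m - u n) * v m + u n * (v m - v n).
    by change (u m * v m - u n * v n = (u m - u n) * v m + u n * (v m - v n)); ring.
  apply: padic_abs_ultra_lt; rewrite padic_absM.
    rewrite -(divfK (lt0r_neq0 B0) e).
    by apply: ltr_pM; rewrite ?padic_abs_ge0 ?cM.
  rewrite mulrC -(divfK (lt0r_neq0 A0) e).
  by apply: ltr_pM; rewrite ?padic_abs_ge0 ?cN.
Qed.

HB.instance Definition _ :=
  GRing.isSubringClosed.Build (nat -> rat) (padic_cauchyb p) padic_cauchy_subring.

End CauchyRing.

Definition padic_seq (p : nat) : Type := {u : nat -> rat | padic_cauchyb p u}.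

HB.instance Definition _ p := SubType.on (padic_seq p).
HB.instance Definition _ p := Choice.on (padic_seq p).
HB.instance Definition _ p := [SubChoice_isSubComNzRing of padic_seq p by <:].

Definition padic_nullb (p : nat) : padic_seq p -> bool :=
  fun u => `[< padic_null p (val u) >].

Section NullIdeal.
Variable p : nat.
Local Notation abs := (padic_abs p).

Lemma padic_seqP (u : padic_seq p) : padic_cauchy p (val u).
Proof. by apply/asboolP; exact: (valP u). Qed.

Lemma padic_null_ideal : idealr_closed (@padic_nullb p).
Proof.
split=> [||w u v /asboolP nu /asboolP nv].
- by apply/asboolP => e e0; exists 0%N => n _; rewrite padic_abs0.
- apply/asboolP => /(_ 1 ltr01) [N /(_ N (leqnn N))].
  by rewrite padic_abs1 ltxx.
- apply/asboolP => e e0; have [A A0 wA] := padic_cauchy_bounded (padic_seqP w).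
  have [M cM] := nu (e / A) (divr_gt0 e0 A0); have [N cN] := nv e e0.
  exists (maxn M N) => n; rewrite geq_max => /andP[Mn Nn].
  apply: padic_abs_ultra_lt; last exact: cN.
  rewrite padic_absM mulrC -(divfK (lt0r_neq0 A0) e).
  by apply: ltr_pM; rewrite ?padic_abs_ge0 ?cM.
Qed.

HB.instance Definition _ := isIdealr.Build (padic_seq p) (@padic_nullb p) padic_null_ideal.

Lemma padic_abs_stable (u : padic_seq p) : ~ padic_null p (val u) ->
  exists2 r : rat, 0 < r & exists N : nat, forall n : nat, (N <= n)%N -> abs (val u n) = r.
Proof.
move=> /existsNP[e /not_implyP[e0 /forallNP nN]].
have [N cN] := padic_seqP u e0.
have /existsNP[n /not_implyP[Nn /negP]] := nN N; rewrite -leNgt => en.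
exists (abs (val u n)); first exact: lt_le_trans en.
exists N => m Nm; rewrite -[val u m](subrK (val u n)) addrC.
by apply: padic_abs_dominant; apply: lt_le_trans en; exact: cN.
Qed.

End NullIdeal.

(* Q_p as the completion of the rationals for |.|_p. The construction makes sense
   for every p: when p is not prime, logn p is 0 and |.|_p is trivial. *)
Definition Qp (p : nat) : Type :=
  {ideal_quot (@padic_nullb p : idealr (padic_seq p))}.

HB.instance Definition _ p := GRing.ComNzRing.on (Qp p).

Section QpField.
Variable p : nat.
Local Notation abs := (padic_abs p).

Lemma Qp_eq (u v : padic_seq p) :
  \pi_(Qp p) u = \pi_(Qp p) v <-> padic_null p (val (u - v)).
Proof.
split=> [/eqP|h]; last apply/eqP.
  by rewrite piE /= Quotient.equivE => /asboolP.
by rewrite piE /= Quotient.equivE; apply/asboolP.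
Qed.

Lemma Qp_mulV (x : Qp p) : x != 0 -> exists y : Qp p, y * x = 1.
Proof.
elim/quotP: x => u _; rewrite -(rmorph0 (\pi_(Qp p))) => /eqP /Qp_eq.
rewrite subr0 => /padic_abs_stable [r r0 [N uN]].
have cv : padic_cauchyb p (fun n => (val u n)^-1).
  apply/asboolP => e e0; have [M cM] := padic_seqP u (mulr_gt0 e0 (mulr_gt0 r0 r0)).
  exists (maxn M N) => m n; rewrite !geq_max => /andP[Mm Nm] /andP[Mn Nn].
  have um0 : val u m != 0 by rewrite -(padic_abs_gt0 p) uN.
  have un0 : val u n != 0 by rewrite -(padic_abs_gt0 p) uN.
  have -> : (val u m)^-1 - (val u n)^-1 = (val u n - val u m) / (val u m * val u n).
    by field; rewrite um0 un0.
  by rewrite padic_absM padic_absV padic_absM !uN // ltr_pdivrMr ?mulr_gt0 // cM.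
exists (\pi_(Qp p) (Sub _ cv : padic_seq p)).
rewrite -rmorphM -(rmorph1 (\pi_(Qp p))); apply/Qp_eq => e e0; exists N => n Nn.
change (abs ((val u n)^-1 * val u n - 1) < e).
by rewrite mulVf ?subrr ?padic_abs0 // -(padic_abs_gt0 p) uN.
Qed.

Definition Qp_inv (x : Qp p) : Qp p := xget 0 [set y | y * x = 1].

Lemma Qp_mulVx (x : Qp p) : x != 0 -> Qp_inv x * x = 1.
Proof. by move=> /Qp_mulV[y yx]; exact: (@xgetPex _ 0 [set z : Qp p | z * x = 1] (ex_intro _ y yx)). Qed.

Lemma Qp_inv0 : Qp_inv 0 = 0.
Proof.
by rewrite /Qp_inv; case: xgetP => // y _ /eqP; rewrite mulr0 eq_sym oner_eq0.
Qed.

HB.instance Definition _ :=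
  GRing.ComNzRing_isField.Build (Qp p) Qp_mulVx Qp_inv0.

End QpField.

(* The limit of the absolute values along a representing sequence: they are
   eventually constant unless the class is 0, in which case the only possible
   eventual value, and the default of xget, is 0. *)
Definition Qp_abs (p : nat) (x : Qp p) : rat :=
  xget 0 [set r | \forall n \near \oo, padic_abs p (val (repr x) n) = r].

Section QpMetric.
Variable p : nat.
Local Notation abs := (padic_abs p).
Implicit Types (u v : padic_seq p) (x y : Qp p).

Lemma Qp_abs_null u : padic_null p (val u) -> Qp_abs (\pi_(Qp p) u) = 0.
Proof.
move=> nu; rewrite /Qp_abs; set v := repr _.
have nv : padic_null p (val v).
  have /Qp_eq nvu : \pi_(Qp p) v = \pi_(Qp p) u by rewrite reprK.
  move=> e e0; have [M hM] := nu e e0; have [N hN] := nvu e e0.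
  exists (maxn M N) => n; rewrite geq_max => /andP[Mn Nn].
  rewrite -[val v n](subrK (val u n)).
  by apply: padic_abs_ultra_lt; [exact: hN | exact: hM].
case: xgetP => // r _ [N _ hN]; apply/eqP; rewrite -[_ == _]negbK; apply/negP => r0.
have {}r0 : 0 < r by rewrite lt0r r0 -(hN N) ?padic_abs_ge0 //=.
have [M hM] := nv r r0.
have := hM (maxn M N) (leq_maxl _ _).
by rewrite (hN (maxn M N)) ?ltxx //= leq_maxr.
Qed.

Lemma Qp_abs_stable u r : 0 < r ->
  (exists N, forall n, (N <= n)%N -> abs (val u n) = r) -> Qp_abs (\pi_(Qp p) u) = r.
Proof.
move=> r0 [N hN]; rewrite /Qp_abs; set v := repr _.
have /Qp_eq nvu : \pi_(Qp p) v = \pi_(Qp p) u by rewrite reprK.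
have [M hM] := nvu r r0.
have vr n : (maxn M N <= n)%N -> abs (val v n) = r.
  rewrite geq_max => /andP[Mn Nn].
  rewrite -[val v n](subrK (val u n)) addrC.
  by rewrite padic_abs_dominant ?hN //; exact: hM.
case: xgetP => [s _ [K _ hK]|/(_ r)]; last by case; exists (maxn M N).
rewrite -(hK (maxn K (maxn M N))) /= ?leq_maxl //.
by rewrite vr // leq_maxr.
Qed.

Lemma Qp_absP x : exists2 u, x = \pi_(Qp p) u &
  (padic_null p (val u) /\ Qp_abs x = 0) \/
  (0 < Qp_abs x /\ exists N, forall n, (N <= n)%N -> abs (val u n) = Qp_abs x).
Proof.
elim/quotP: x => u _; exists u => //.
have [nu|nnu] := pselect (padic_null p (val u)).
  by left; rewrite Qp_abs_null.
have [r r0 hr] := padic_abs_stable nnu.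
by right; rewrite (Qp_abs_stable r0 hr).
Qed.

Lemma Qp_abs_ge0 x : 0 <= Qp_abs x.
Proof. by have [u _ [[_ ->]|[/ltW]]] := Qp_absP x. Qed.

Lemma Qp_abs0 : Qp_abs (0 : Qp p) = 0.
Proof.
rewrite -(rmorph0 (\pi_(Qp p))) Qp_abs_null // => e e0.
by exists 0%N => n _; rewrite padic_abs0.
Qed.

Lemma Qp_abs_eq0 x : (Qp_abs x == 0) = (x == 0).
Proof.
apply/eqP/eqP => [x0|->]; last exact: Qp_abs0.
have [u xu [[nu _]|[]]] := Qp_absP x; last by rewrite x0 ltxx.
by rewrite xu -(rmorph0 (\pi_(Qp p))); apply/Qp_eq; rewrite subr0.
Qed.

Lemma Qp_abs_lt u (e : rat) : 0 < e ->
  Qp_abs (\pi_(Qp p) u) < e <->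
  exists N, forall n, (N <= n)%N -> abs (val u n) < e.
Proof.
move=> e0; have [nu|nnu] := pselect (padic_null p (val u)).
  by rewrite Qp_abs_null //; split=> // _; exact: nu.
have [r r0 [N hN]] := padic_abs_stable nnu.
rewrite (Qp_abs_stable r0); last by exists N.
split=> [re|[M hM]]; first by exists N => n /hN ->.
by rewrite -(hN (maxn M N)) ?leq_maxr // hM // leq_maxl.
Qed.

Lemma Qp_abs_ultra_lt x y (e : rat) :
  Qp_abs x < e -> Qp_abs y < e -> Qp_abs (x + y) < e.
Proof.
elim/quotP: x => u _; elim/quotP: y => v _ ue ve.
have e0 : 0 < e by exact: le_lt_trans (Qp_abs_ge0 _) ue.
move: ue ve; rewrite !Qp_abs_lt // => -[M hM] [N hN].
rewrite -rmorphD Qp_abs_lt //; exists (maxn M N) => n.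
rewrite geq_max => /andP[Mn Nn].
by apply: padic_abs_ultra_lt; [exact: hM | exact: hN].
Qed.

Lemma Qp_abs_ultra x y : Qp_abs (x + y) <= Num.max (Qp_abs x) (Qp_abs y).
Proof.
rewrite leNgt; apply/negP; rewrite gt_max => /andP[hx hy].
by have := Qp_abs_ultra_lt hx hy; rewrite ltxx.
Qed.

Lemma Qp_absN x : Qp_abs (- x) = Qp_abs x.
Proof.
have le y : Qp_abs (- y) <= Qp_abs y.
  rewrite leNgt; apply/negP; elim/quotP: y => u _; rewrite -rmorphN => h.
  have e0 := le_lt_trans (Qp_abs_ge0 _) h.
  move: (h); rewrite (Qp_abs_lt u e0) => -[N hN].
  have : Qp_abs (\pi_(Qp p) (- u)) < Qp_abs (\pi_(Qp p) (- u)).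
    by apply/(Qp_abs_lt _ e0); exists N => n /hN; rewrite -padic_absN.
  by rewrite ltxx.
by apply/eqP; rewrite eq_le le -{1}[x]opprK le.
Qed.

Lemma Qp_absM x y : Qp_abs (x * y) = Qp_abs x * Qp_abs y.
Proof.
have [->|x0] := eqVneq x 0; first by rewrite mul0r Qp_abs0 mul0r.
have [->|y0] := eqVneq y 0; first by rewrite mulr0 Qp_abs0 mulr0.
have [u xu [[_ /eqP]|[rx [M hM]]]] := Qp_absP x; first by rewrite Qp_abs_eq0 (negPf x0).
have [v yv [[_ /eqP]|[ry [N hN]]]] := Qp_absP y; first by rewrite Qp_abs_eq0 (negPf y0).
rewrite {1}xu {1}yv -rmorphM; apply: Qp_abs_stable; first exact: mulr_gt0.
exists (maxn M N) => n; rewrite geq_max => /andP[Mn Nn].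
by rewrite -(hM n) // -(hN n) // -padic_absM.
Qed.

Definition Qp_dist x y : rat := Qp_abs (x - y).

Lemma Qp_distxx x : Qp_dist x x = 0.
Proof. by rewrite /Qp_dist subrr Qp_abs0. Qed.

Lemma Qp_dist_positivity x y : Qp_dist x y = 0 -> x = y.
Proof. by move=> /eqP; rewrite Qp_abs_eq0 subr_eq0 => /eqP. Qed.

Lemma Qp_dist_sym x y : Qp_dist x y = Qp_dist y x.
Proof. by rewrite /Qp_dist -Qp_absN opprB. Qed.

Lemma Qp_dist_triangle y x z : Qp_dist x z <= Qp_dist x y + Qp_dist y z.
Proof.
rewrite /Qp_dist -[x - z](subrKA y); apply: le_trans (Qp_abs_ultra _ _) _.
by rewrite ge_max lerDl lerDr !Qp_abs_ge0.
Qed.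

HB.instance Definition _ := isMetric.Build rat (Qp p)
  Qp_distxx Qp_dist_positivity Qp_dist_sym Qp_dist_triangle.

End QpMetric.

Section QpOfRat.
Variable p : nat.

Lemma padic_cauchy_cst (a : rat) : padic_cauchyb p (fun=> a).
Proof.
by apply/asboolP => e e0; exists 0%N => m n _ _; rewrite subrr padic_abs0.
Qed.

Definition Qp_of_rat (a : rat) : Qp p :=
  \pi_(Qp p) (Sub (fun=> a) (padic_cauchy_cst a) : padic_seq p).

Lemma Qp_of_rat_zmod_morphism : zmod_morphism Qp_of_rat.
Proof. by move=> a b; rewrite /Qp_of_rat -rmorphB; congr (\pi_(Qp p) _); exact: val_inj. Qed.

Lemma Qp_of_rat_monoid_morphism : monoid_morphism Qp_of_rat.
Proof.
split=> [|a b]; first by rewrite -(rmorph1 (\pi_(Qp p))); congr (\pi_(Qp p) _); exact: val_inj.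
by rewrite /Qp_of_rat -rmorphM; congr (\pi_(Qp p) _); exact: val_inj.
Qed.

HB.instance Definition _ :=
  GRing.isZmodMorphism.Build rat (Qp p) Qp_of_rat Qp_of_rat_zmod_morphism.
HB.instance Definition _ :=
  GRing.isMonoidMorphism.Build rat (Qp p) Qp_of_rat Qp_of_rat_monoid_morphism.

Lemma Qp_abs_rat (a : rat) : Qp_abs (Qp_of_rat a) = padic_abs p a.
Proof.
have [->|a0] := eqVneq a 0; first by rewrite rmorph0 Qp_abs0 padic_abs0.
by apply: Qp_abs_stable; [rewrite padic_abs_gt0 | exists 0%N].
Qed.

End QpOfRat.

(* As a set_type, it carries the subspace topology of the product topology. *)
Definition Qp_vec (p : nat) : Type := [set v : Qp p * Qp p | v != 0].

HB.instance Definition _ p := Topological.on (Qp_vec p).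

Definition Qp_propor (p : nat) (v w : Qp_vec p) : bool :=
  `[< exists2 c : Qp p, c != 0 & val w = (c * (val v).1, c * (val v).2) >].

Section ProjLine.
Variable p : nat.

Lemma Qp_propor_equiv : equiv_class_of (@Qp_propor p).
Proof.
split=> [v|v w|v u w].
- apply/asboolP; exists 1; first exact: oner_neq0.
  by rewrite !mul1r -surjective_pairing.
- apply/asboolP/asboolP => -[c c0 ->] /=; exists c^-1; rewrite ?invr_eq0 //=;
    by rewrite !mulKf // -surjective_pairing.
- move=> /asboolP[c c0 Eu] /asboolP[d d0 Ew]; apply/asboolP.
  by exists (d * c); rewrite ?mulf_neq0 // Ew Eu /= !mulrA.
Qed.

Canonical Qp_propor_equivRel := EquivRelPack Qp_propor_equiv.
Canonical Qp_propor_encModRel := defaultEncModRel (@Qp_propor p).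

End ProjLine.

Definition P1 (p : nat) : Type := quotient_topology {eq_quot (@Qp_propor p)}.

Definition P1_point (p : nat) (x y : Qp p) (xy0 : (x, y) != 0) : P1 p :=
  \pi_({eq_quot (@Qp_propor p)}) (exist _ (x, y) (mem_set xy0) : Qp_vec p).

Section ContinuedFraction.
Variable F : fieldType.
Implicit Types (c : nat -> F) (n : nat).

(* The partial quotients are c 1, c 2, and so on; c 0 is not used. *)
Fixpoint cf_A c n : F :=
  match n with
  | 0 => 1
  | (m.+1) as n1 => match m with
                    | 0 => c 1%N
                    | l.+1 => cf_A c m * c n1 + cf_A c l
                    end
  end.

Fixpoint cf_B c n : F :=
  match n with
  | 0 => 0
  | (m.+1) as n1 => match m with
                    | 0 => 1
                    | l.+1 => cf_B c m * c n1 + cf_B c l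
                    end
  end.

Definition cf_M (s : seq F) : 'M[F]_2 :=
  \prod_(x <- s) \matrix_(i, j) nth 0 (nth [::] [:: [:: x; 1]; [:: 1; 0]] i) j.

Lemma cf_AB_det c n :
  cf_A c n.+1 * cf_B c n - cf_A c n * cf_B c n.+1 = (-1) ^+ n.+1.
Proof.
elim: n => [|n IH]; first by rewrite /= mulr0 mulr1 sub0r expr1.
by rewrite exprS -IH /=; ring.
Qed.

Lemma cf_AB_neq0 c n : (cf_A c n, cf_B c n) != 0.
Proof.
apply/eqP => -[A0 B0]; have := cf_AB_det c n; rewrite A0 B0 mulr0 mul0r subr0.
by apply/eqP; rewrite eq_sym signr_eq0.
Qed.

Lemma cf_ME c n : cf_M [seq c i | i <- iota 1 n.+1] =
  \matrix_(i, j) nth 0 (nth [::] [:: [:: cf_A c n.+1; cf_A c n];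
                                     [:: cf_B c n.+1; cf_B c n]] i) j.
Proof.
elim: n => [|n IH]; first by rewrite /cf_M big_seq1.
have -> : iota 1 n.+2 = iota 1 n.+1 ++ [:: n.+2] by rewrite -[in LHS](addn1 n.+1) iotaD add1n.
rewrite map_cat /cf_M big_cat /= -/(cf_M _) IH big_seq1.
apply/matrixP => i j; rewrite !mxE !big_ord_recl big_ord0 !mxE addr0.
by case: i => [[|[|//]] ?]; case: j => [[|[|//]] ?] /=; rewrite ?mulr1 ?mulr0 ?addr0.
Qed.

End ContinuedFraction.

Definition cf_convergent (p : nat) (c : nat -> Qp p) (n : nat) : P1 p :=
  P1_point (cf_AB_neq0 c n).

Definition cf_converges (p : nat) (c : nat -> Qp p) : Prop :=
  exists l : P1 p, cf_convergent c n @[n --> \oo] --> l.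

Definition in_Zinv (p : nat) (x : rat) : Prop :=
  exists (m : int) (n : nat), x = m%:~R / p%:R ^+ n.

(* The k-periodic sequence with values a_1, ..., a_k at 1, ..., k; the tuple
   itself is indexed from 0. *)
Definition cf_periodic (k : nat) (a : k.-tuple rat) (n : nat) : rat :=
  nth 0 a (n.-1 %% k)%N.

(* Main.v *)
(* Write v_n = (A_n, B_n) and |.| for the sup norm on Q_p^2. The chordal distance
   |det(v,w)| / (|v| |w|) is an ultrametric for which P^1(Q_p) is complete, and
   consecutive convergents are at distance 1 / (|v_n| |v_{n+1}|); so convergence
   amounts to |v_n| |v_{n+1}| -> oo. With M = M(a_1,...,a_k) of trace T, periodicity
   gives v_{n+mk} = M^m v_n, hence v_{n+2k} = T v_{n+k} -+ v_n. If |T| <= 1 the v_n are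
   bounded. If |T| > 1, each orbit m |-> |M^m v_n| grows unless v_n is a contracted
   eigenvector of M; conjugating by M(a_1,...,a_n), this means that
   M(a_{n+1},...,a_{n+k}) has (2,1) entry 0 and (2,2) entry of absolute value > 1.
   For such an n the product |v_{n+mk}| |v_{n+mk+1}| stays bounded. *)
Require Import Defs.
From mathcomp Require Import all_boot all_order all_algebra.
From mathcomp Require Import all_classical topology ring.
Import Order.TTheory GRing.Theory Num.Theory.
Local Open Scope classical_set_scope.
Local Open Scope ring_scope.
Local Open Scope quotient_scope.

Set Implicit Arguments.
Unset Strict Implicit.
Unset Printing Implicit Defensive.

(** * Sup norm and chordal distance on the plane over Q_p *)

Section Plane.
Variable p : nat.
Local Notation abs := (@Qp_abs p).
Implicit Types (x y : Qp p) (v w l : Qp p * Qp p) (e : rat).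

Lemma Qp_abs1 : abs 1 = 1.
Proof. by rewrite -(rmorph1 (@Qp_of_rat p)) Qp_abs_rat padic_abs1. Qed.

Lemma Qp_abs_sign n : abs ((-1) ^+ n) = 1.
Proof. by elim: n => [|n IH]; rewrite ?Qp_abs1 // exprS Qp_absM IH Qp_absN Qp_abs1 mulr1. Qed.

Lemma Qp_absX x n : abs (x ^+ n) = abs x ^+ n.
Proof. by elim: n => [|n IH]; rewrite ?Qp_abs1 // !exprS Qp_absM IH. Qed.

Lemma Qp_absB_le x y e : abs x <= e -> abs y <= e -> abs (x - y) <= e.
Proof.
by move=> xe ye; apply: le_trans (Qp_abs_ultra _ _) _; rewrite ge_max xe Qp_absN.
Qed.

Lemma Qp_abs_dominant x y : abs y < abs x -> abs (x + y) = abs x.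
Proof.
move=> yx; apply/eqP; rewrite eq_le; apply/andP; split.
  by apply: le_trans (Qp_abs_ultra _ _) _; rewrite ge_max lexx ltW.
have := Qp_abs_ultra (x + y) (- y); rewrite addrK Qp_absN le_max.
by case/orP => // /(lt_le_trans yx); rewrite ltxx.
Qed.

Definition sup_norm v : rat := Num.max (abs v.1) (abs v.2).
Definition cross v w : Qp p := v.1 * w.2 - v.2 * w.1.
Definition dilate x v : Qp p * Qp p := (x * v.1, x * v.2).

Lemma sup_norm_ge0 v : 0 <= sup_norm v.
Proof. by rewrite le_max Qp_abs_ge0. Qed.

Lemma sup_norm_gt0 v : (0 < sup_norm v) = (v != 0).
Proof.
rewrite lt_max !lt_def !Qp_abs_ge0 !andbT !Qp_abs_eq0 -negb_and.
by case: v => x y.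
Qed.

Lemma sup_norm_le v e : (sup_norm v <= e) = (abs v.1 <= e) && (abs v.2 <= e).
Proof. exact: ge_max. Qed.

Lemma sup_normN v : sup_norm (- v) = sup_norm v.
Proof. by rewrite /sup_norm /= !Qp_absN. Qed.

Lemma sup_norm_dilate x v : sup_norm (dilate x v) = abs x * sup_norm v.
Proof. by rewrite /sup_norm /= !Qp_absM maxr_pMr ?Qp_abs_ge0. Qed.

Lemma sup_norm_ultra v w : sup_norm (v + w) <= Num.max (sup_norm v) (sup_norm w).
Proof.
rewrite sup_norm_le /=; apply/andP; split; apply: le_trans (Qp_abs_ultra _ _) _;
  by rewrite ge_max !le_max !lexx !orbT.
Qed.

Lemma sup_norm_dominant v w : sup_norm w < sup_norm v -> sup_norm (v + w) = sup_norm v.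
Proof.
move=> wv; apply/eqP; rewrite eq_le; apply/andP; split.
  by apply: le_trans (sup_norm_ultra _ _) _; rewrite ge_max lexx ltW.
have := sup_norm_ultra (v + w) (- w); rewrite addrK sup_normN le_max.
by case/orP => // /(lt_le_trans wv); rewrite ltxx.
Qed.

Lemma cross_le v w : abs (cross v w) <= sup_norm v * sup_norm w.
Proof.
by apply: Qp_absB_le; rewrite Qp_absM ler_pM ?Qp_abs_ge0 // le_max lexx ?orbT.
Qed.

(* The Plücker relation det(v,w) l = det(v,l) w + det(l,w) v makes the chordal
   distance |det(v,w)| / (|v| |w|) an ultrametric on the projective line. *)
Lemma cross_ultra l v w :
  abs (cross v w) * sup_norm l
    <= Num.max (abs (cross v l) * sup_norm w) (abs (cross l w) * sup_norm v).
Proof.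
rewrite -!sup_norm_dilate.
have -> : dilate (cross v w) l = dilate (cross v l) w + dilate (cross l w) v.
  by rewrite /dilate /cross; congr (_, _) => /=; ring.
exact: sup_norm_ultra.
Qed.

Lemma cross_dilate x v l : cross l (dilate x v) = x * cross l v.
Proof. by rewrite /cross /=; ring. Qed.

(** The strict inequality forces [w] to be nonzero, and near such a [w] the ultrametric [sup_norm]
    is constant, so only the determinant has to be controlled. *)
Lemma open_chordal_ball l e :
  open [set w : Qp p * Qp p | abs (cross l w) < e * sup_norm w].
Proof.
rewrite openE => w /= lw; apply/nbhs_ballP.
have w0 : 0 < sup_norm w.
  rewrite lt_def sup_norm_ge0 andbT; apply/eqP => w0.
  by move: lw; rewrite w0 mulr0 ltNge Qp_abs_ge0.
have e0 : 0 < e.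
  by rewrite -(pmulr_lgt0 _ w0); apply: le_lt_trans lw; exact: Qp_abs_ge0.
have l0 : 0 < sup_norm l + 1 by rewrite ltr_wpDl // sup_norm_ge0.
(* The first bound keeps |u| = |w|, the second makes |det(l, u - w)| < e |w|; adding 1 covers
   [l = 0]. *)
exists (Num.min (sup_norm w) (e * sup_norm w / (sup_norm l + 1))).
  by rewrite /= lt_min w0 divr_gt0 ?mulr_gt0.
move=> u [] /=; rewrite !ballEmdist /= => u1 u2.
have : sup_norm (u - w) < Num.min (sup_norm w) (e * sup_norm w / (sup_norm l + 1)).
  rewrite [sup_norm (u - w)]/sup_norm gt_max -!(Qp_absN (u - w).1).
  by rewrite -!(Qp_absN (u - w).2) /= !opprB; apply/andP; split; [exact: u1|exact: u2].
rewrite lt_min => /andP[uw uw']; rewrite -(subrKC w u).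
rewrite [sup_norm _]sup_norm_dominant //.
have -> : cross l (w + (u - w)) = cross l w + cross l (u - w).
  by rewrite /cross /=; ring.
apply: Qp_abs_ultra_lt => //; apply: le_lt_trans (cross_le _ _) _.
move: uw'; rewrite ltr_pdivlMr //; apply: le_lt_trans.
by rewrite mulrC ler_wpM2l ?sup_norm_ge0 // lerDl.
Qed.

End Plane.

(** * Convergence in the quotient topology of the projective line *)

Section Convergence.
Variable p : nat.
Local Notation abs := (@Qp_abs p).
Variables (x y : nat -> Qp p) (xy0 : forall n, (x n, y n) != 0).
Local Notation v n := (x n, y n).

(** Both sides of the inequality scale by the same factor when the vector is dilated, so chordal
    balls descend to open sets of P^1. *)
Lemma chordal_cvg (l : P1 p) : P1_point (xy0 n) @[n --> \oo] --> l ->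
  exists2 w : Qp p * Qp p, w != 0 & forall e, 0 < e ->
    exists N, forall n, (N <= n)%N -> abs (cross w (v n)) < e * sup_norm (v n).
Proof.
elim/quotP: l => w _ xyl; have w0 := set_mem (valP w); exists (val w) => // e e0.
pose C (u : Qp p * Qp p) := abs (cross (val w) u) < e * sup_norm u.
have Cpi (u : Qp_vec p) : C (val (repr (\pi_(P1 p) u))) = C (val u).
  have /eqmodP/asboolP [c c0 Eu] : \pi_({eq_quot (@Qp_propor p)}) u
      = \pi_({eq_quot (@Qp_propor p)}) (repr (\pi_(P1 p) u)).
    by rewrite (reprK (\pi_({eq_quot (@Qp_propor p)}) u)).
  rewrite Eu -/(dilate c (val u)) /C cross_dilate sup_norm_dilate Qp_absM mulrCA.
  by rewrite ltr_pM2l // lt_def Qp_abs_eq0 c0 Qp_abs_ge0.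
have oC : open [set q : P1 p | C (val (repr q))].
  exists [set u | C u]; first exact: open_chordal_ball.
  by apply/seteqP; split => u /=; rewrite Cpi.
have /xyl [N _ NC] : nbhs (\pi_(P1 p) w) [set q : P1 p | C (val (repr q))].
  apply: open_nbhs_nbhs; split => //=; rewrite Cpi /C /cross mulrC subrr Qp_abs0.
  by rewrite mulr_gt0 // sup_norm_gt0.
exists N => n /NC /=; rewrite Cpi; exact.
Qed.

(** The projection to P^1 is continuous, so it suffices to rescale representatives until they
    converge in the plane. *)
Lemma cvg_dilate (s : nat -> Qp p) (w : Qp p * Qp p) (w0 : w != 0) :
    (exists N, forall n, (N <= n)%N -> s n != 0) ->
    (forall e, 0 < e -> exists N, forall n, (N <= n)%N ->
      sup_norm (w - dilate (s n) (v n)) < e) ->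
  P1_point (xy0 n) @[n --> \oo] --> (\pi_(P1 p) (exist _ w (mem_set w0) : Qp_vec p)).
Proof.
move=> [N s0] svw.
have sv0 n : s n != 0 -> dilate (s n) (v n) != 0.
  move=> sn0; have := xy0 n; rewrite -!sup_norm_gt0 sup_norm_dilate => h.
  by rewrite mulr_gt0 // lt_def Qp_abs_eq0 sn0 Qp_abs_ge0.
(* [Qp_vec] has nonzero vectors only, so an index with [s n = 0] gets the default [w]; this does not
   happen from [N] on. *)
pose u n : Qp_vec p := if @idP (s n != 0) is ReflectT h
  then exist _ (dilate (s n) (v n)) (mem_set (sv0 _ h))
  else exist _ w (mem_set w0).
have uE n : (N <= n)%N -> val (u n) = dilate (s n) (v n).
  by move=> Nn; rewrite /u; case: {-}_ / idP => // /(_ (s0 _ Nn)).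
have uw : u n @[n --> \oo] --> (exist _ w (mem_set w0) : Qp_vec p).
  move=> V [_ [[A oA <-] Aw] AV].
  have /nbhs_ballP [e e0 eA] : nbhs w A by exact: open_nbhs_nbhs.
  have [M hM] := svw e e0; exists (maxn M N) => // n /=.
  rewrite geq_max => /andP[Mn Nn]; apply: AV; apply: eA; rewrite [set_val _]uE //.
  have := hM n Mn; rewrite gt_max => /andP[h1 h2].
  by split; rewrite ballEmdist.
have piu : \pi_(P1 p) (u n) @[n --> \oo] --> (\pi_(P1 p) (exist _ w (mem_set w0) : Qp_vec p)).
  have h := @pi_continuous (Qp_vec p) {eq_quot (@Qp_propor p)} (exist _ w (mem_set w0)).
  exact: (cvg_comp _ _ uw h).
apply: cvg_trans piu; apply: near_eq_cvg; exists N => // n /= Nn.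
apply/esym/eqmodP/asboolP; exists (s n); first exact: s0.
by rewrite uE.
Qed.

End Convergence.

(** * Completeness of Q_p and of the projective line *)

Lemma Qp_of_rat_cvg (p : nat) (u : nat -> rat) : padic_cauchy p u ->
  exists z : Qp p, forall e, 0 < e ->
    exists N, forall n, (N <= n)%N -> Qp_abs (z - Qp_of_rat p (u n)) < e.
Proof.
move=> cu; have cb : padic_cauchyb p u by exact/asboolP.
(* The limit is the class of the sequence itself. *)
exists (\pi_(Qp p) (Sub u cb : padic_seq p)) => e e0.
have [N hN] := cu e e0; exists N => n Nn.
rewrite -rmorphB; apply/(Qp_abs_lt _ e0); exists N => m Nm; exact: hN.
Qed.

Lemma expr_unbounded (t C : rat) : 1 < t ->
  exists N, forall n, (N <= n)%N -> C < t ^+ n.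
Proof.
move=> t1; have t10 : 0 < t - 1 by rewrite subr_gt0.
have bernoulli n : n%:R * (t - 1) <= t ^+ n.
  elim: n => [|n IH]; first by rewrite mul0r.
  have h : 1 * (t - 1) <= t ^+ n * (t - 1).
    by apply: ler_wpM2r; [exact: ltW | exact: exprn_ege1 (ltW t1)].
  rewrite -natr1 mulrDl exprS; have -> : t * t ^+ n = t ^+ n + t ^+ n * (t - 1) by ring.
  exact: lerD.
exists (Num.Def.archi_bound (`|C / (t - 1)|)) => n Nn.
apply: (lt_le_trans _ (bernoulli n)); rewrite -ltr_pdivrMr //.
apply: le_lt_trans (ler_norm _) _; apply: lt_le_trans (archi_boundP (normr_ge0 _)) _.
by rewrite ler_nat.
Qed.

Lemma sub_fractions (F : fieldType) (a b c d : F) : b != 0 -> d != 0 ->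
  a / b - c / d = (a * d - b * c) / (b * d).
Proof. by move=> b0 d0; field; rewrite ?b0 ?d0. Qed.

Section Completeness.
Variable p : nat.
Local Notation abs := (@Qp_abs p).
Local Notation "a %:Qp" := (Qp_of_rat p a) (at level 2, format "a %:Qp").

(** If the first coordinate of [w] were strictly larger, [v.2 * w.1] would dominate the determinant
    and put the points at chordal distance 1. So points at distance less than 1 share an affine
    chart. *)
Lemma dominant_coord (v w : Qp p * Qp p) : v != 0 ->
    abs (cross v w) < sup_norm v * sup_norm w ->
  abs v.1 <= abs v.2 -> abs w.1 <= abs w.2.
Proof.
rewrite -sup_norm_gt0 /sup_norm => + + v12; rewrite (max_idPr v12) => v0 vw.
rewrite leNgt; apply/negP => w21; move: vw.
rewrite (max_idPl (ltW w21)) /cross addrC Qp_abs_dominant.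
  by rewrite Qp_absN Qp_absM ltxx.
rewrite Qp_absN !Qp_absM; apply: (@le_lt_trans _ _ (abs v.2 * abs w.2)).
  by rewrite ler_wpM2r ?Qp_abs_ge0.
by rewrite ltr_pM2l.
Qed.

(** Where the second coordinate dominates, the chordal distance is |A_n/B_n - A_m/B_m|, so these
    rational ratios form a Cauchy sequence and define an element of Q_p. *)
Lemma ratio_cvg (A B : nat -> rat) (v := fun n => ((A n)%:Qp, (B n)%:Qp)) :
    (forall n, v n != 0) ->
    (forall e, 0 < e -> exists N, forall n m, (N <= n)%N -> (N <= m)%N ->
      abs (cross (v n) (v m)) < e * (sup_norm (v n) * sup_norm (v m))) ->
    (exists N, forall n, (N <= n)%N -> abs (v n).1 <= abs (v n).2) ->
  exists2 z, exists N, forall n, (N <= n)%N -> (B n)%:Qp != 0 &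
    forall e, 0 < e -> exists N, forall n, (N <= n)%N ->
      abs (z - (A n)%:Qp / (B n)%:Qp) < e.
Proof.
move=> v0 cv [N AB].
have nB n : (N <= n)%N -> sup_norm (v n) = abs (B n)%:Qp by move=> /AB /max_idPr.
have B0 n : (N <= n)%N -> (B n)%:Qp != 0.
  by move=> Nn; have := v0 n; rewrite -sup_norm_gt0 nB // lt_def Qp_abs_eq0 => /andP[].
have [z hz] : exists z : Qp p, forall e, 0 < e -> exists N, forall n, (N <= n)%N ->
    abs (z - (A n / B n)%:Qp) < e.
  apply: Qp_of_rat_cvg => e e0; have [M hM] := cv e e0.
  exists (maxn M N) => m n; rewrite !geq_max => /andP[Mm Nm] /andP[Mn Nn].
  have := hM m n Mm Mn; rewrite !nB // -Qp_absM -ltr_pdivrMr; last first.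
    by rewrite lt_def Qp_abs_eq0 mulf_neq0 ?B0 // Qp_abs_ge0.
  rewrite -Qp_abs_rat; apply: le_lt_trans; rewrite le_eqVlt; apply/orP; left; apply/eqP.
  have -> : (A m / B m - A n / B n)%:Qp
      = cross (v m) (v n) / ((B m)%:Qp * (B n)%:Qp).
    rewrite [LHS](rmorphB (Qp_of_rat p)) 2!(fmorph_div (Qp_of_rat p)).
    exact: sub_fractions (B0 _ Nm) (B0 _ Nn).
  rewrite Qp_absM; congr (_ * _).
  apply: (@mulfI _ (abs ((B m)%:Qp * (B n)%:Qp))).
    by rewrite Qp_abs_eq0 mulf_neq0 ?B0.
  by rewrite -Qp_absM !mulfV ?Qp_abs1 // ?Qp_abs_eq0 mulf_neq0 ?B0.
exists z; first by exists N.
by move=> e /hz[M hM]; exists M => n /hM; rewrite fmorph_div.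
Qed.

Lemma P1_cvg_iff (A B : nat -> rat) (x y : nat -> Qp p) (v := fun n => (x n, y n))
    (v0 : forall n, v n != 0) :
    x =1 (fun n => (A n)%:Qp) -> y =1 (fun n => (B n)%:Qp) ->
    (forall n, abs (cross (v n) (v n.+1)) = 1) ->
  (exists l : P1 p, P1_point (v0 n) @[n --> \oo] --> l) <->
  (forall C, exists N, forall n, (N <= n)%N -> C < sup_norm (v n) * sup_norm (v n.+1)).
Proof.
move=> /funext xA /funext yB; subst x y.
move=> v1; have nv0 n : 0 < sup_norm (v n) by rewrite sup_norm_gt0.
split=> [[l /chordal_cvg[w w0 hw]] C|hC].
  have D0 : 0 < `|C| + 1 by rewrite ltr_wpDl.
  rewrite -sup_norm_gt0 in w0.
  (* This radius puts v_n and v_{n+1} within chordal distance 1 / (|C| + 1) of the limit, hence of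
     each other, and their distance is 1 / (|v_n| |v_{n+1}|). *)
  have [N hN] := hw _ (divr_gt0 w0 D0); exists N => n Nn.
  apply: le_lt_trans (ler_norm C) _; apply: (@lt_trans _ _ (`|C| + 1)); rewrite ?ltrDl //.
  have := cross_ultra w (v n) (v n.+1); rewrite v1 mul1r le_max.
  have cC u : cross u w = - cross w u by rewrite /cross; ring.
  rewrite cC Qp_absN => h.
  suff : sup_norm w < sup_norm w / (`|C| + 1) * (sup_norm (v n) * sup_norm (v n.+1)).
    by rewrite mulrAC ltr_pdivlMr // ltr_pM2l.
  case/orP: h => h; apply: le_lt_trans h _.
    by rewrite mulrA ltr_pM2r // hN.
  by rewrite [sup_norm (v n) * _]mulrC mulrA ltr_pM2r // hN // ltnW.
have cv e : 0 < e -> exists N, forall n m, (N <= n)%N -> (N <= m)%N ->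
    abs (cross (v n) (v m)) < e * (sup_norm (v n) * sup_norm (v m)).
  (* Beyond the threshold for 1/e, consecutive points are at distance less than [e]; the ultrametric
     inequality extends this to all pairs. *)
  move=> e0; have [N hN] := hC e^-1; exists N => n m.
  wlog nm : n m / (n <= m)%N => [hw Nn Nm|Nn _].
    have [/hw|/ltnW /hw] := leqP n m; first exact.
    rewrite [sup_norm (v n) * _]mulrC; have -> : cross (v n) (v m) = - cross (v m) (v n).
      by rewrite /cross; ring.
    by rewrite Qp_absN; exact.
  rewrite -(subnK nm) addnC; elim: (m - n)%N => [|i IH].
    by rewrite addn0 /cross mulrC subrr Qp_abs0 !mulr_gt0.
  rewrite addnS; set j := (n + i)%N in IH *.
  rewrite -(ltr_pM2r (nv0 j)); apply: le_lt_trans (cross_ultra _ _ _) _.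
  rewrite v1 mul1r gt_max; apply/andP; split.
    have -> : e * (sup_norm (v n) * sup_norm (v j.+1)) * sup_norm (v j)
      = e * (sup_norm (v n) * sup_norm (v j)) * sup_norm (v j.+1) by ring.
    by rewrite ltr_pM2r.
  have -> : e * (sup_norm (v n) * sup_norm (v j.+1)) * sup_norm (v j)
      = (sup_norm (v j) * sup_norm (v j.+1)) * e * sup_norm (v n) by ring.
  rewrite -{1}[sup_norm (v n)]mul1r ltr_pM2r // -ltr_pdivrMr // div1r hN //.
  exact: leq_trans Nn (leq_addr _ _).
(* From [N] on, all points are at distance less than 1 from v_N, so they stay in its affine
   chart. *)
have [N hN] := cv 1 ltr01.
have [v12|v21] := leP (abs (v N).1) (abs (v N).2).
  have [|z [M B0] hz] := @ratio_cvg A B v0 cv.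
    exists N => n Nn; apply: (@dominant_coord (v N)) => //.
    by have := hN N n (leqnn _) Nn; rewrite mul1r.
  have z1 : (z, 1) != 0 :> Qp p * Qp p.
    by apply/eqP => -[_ /eqP]; rewrite oner_eq0.
  eexists; apply: (@cvg_dilate p _ _ v0 (fun n => ((B n)%:Qp)^-1) _ z1).
    by exists M => n /B0; rewrite invr_eq0.
  move=> e e0; have [L hL] := hz e e0; exists (maxn L M) => n.
  rewrite geq_max => /andP[Ln Mn]; rewrite /sup_norm /= mulVf ?B0 // subrr Qp_abs0.
  by rewrite gt_max e0 andbT mulrC hL.
(* In the other chart the coordinates are swapped, which only changes the sign of the
   determinant. *)
have w0 n : ((B n)%:Qp, (A n)%:Qp) != 0.
  by apply/eqP => -[b0 a0]; move: (v0 n); rewrite /v b0 a0 eqxx.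
have [||z [M B0] hz] := @ratio_cvg B A w0.
- move=> e /cv[M hM]; exists M => n m /hM h /h.
  rewrite /sup_norm /= ![Num.max (abs (B _)%:Qp) _]maxC.
  have -> : cross ((B n)%:Qp, (A n)%:Qp) ((B m)%:Qp, (A m)%:Qp) = - cross (v n) (v m).
    by rewrite /cross /v /=; ring.
  by rewrite Qp_absN.
- exists N => n Nn.
  apply: (@dominant_coord ((B N)%:Qp, (A N)%:Qp) ((B n)%:Qp, (A n)%:Qp)) => //.
  2: exact: ltW.
  have := hN N n (leqnn _) Nn; rewrite mul1r.
  rewrite /sup_norm /= ![Num.max (abs (B _)%:Qp) _]maxC.
  have -> : cross ((B N)%:Qp, (A N)%:Qp) ((B n)%:Qp, (A n)%:Qp) = - cross (v N) (v n).
    by rewrite /cross /v /=; ring.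
  by rewrite Qp_absN.
have z1 : (1, z) != 0 :> Qp p * Qp p.
  by apply/eqP => -[/eqP]; rewrite oner_eq0.
eexists; apply: (@cvg_dilate p _ _ v0 (fun n => ((A n)%:Qp)^-1) _ z1).
  by exists M => n /B0; rewrite invr_eq0.
move=> e e0; have [L hL] := hz e e0; exists (maxn L M) => n.
rewrite geq_max => /andP[Ln Mn]; rewrite /sup_norm /= mulVf ?B0 // subrr Qp_abs0.
by rewrite gt_max e0 mulrC hL.
Qed.

End Completeness.

(** * Iteration of a two by two matrix with |det| = 1 *)

Lemma tr_mx2 (R : pzSemiRingType) (M : 'M[R]_2) : \tr M = M 0 0 + M 1 1.
Proof.
rewrite /mxtrace !big_ord_recl big_ord0 addr0; congr (_ + M _ _); exact: val_inj.
Qed.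

Lemma det_mx2 (R : comNzRingType) (M : 'M[R]_2) :
  \det M = M 0 0 * M 1 1 - M 0 1 * M 1 0.
Proof.
rewrite (expand_det_row _ 0) !big_ord_recl big_ord0 addr0 /cofactor !det_mx11 !mxE /=.
rewrite expr0 mul1r expr1 mulN1r mulrN.
by congr (M _ _ * M _ _ - M _ _ * M _ _); apply: val_inj.
Qed.

Section Iteration.
Variables (p : nat) (M : 'M[Qp p]_2).
Local Notation abs := (@Qp_abs p).
Implicit Types (v w : Qp p * Qp p).

Definition lin v : Qp p * Qp p :=
  (M 0 0 * v.1 + M 0 1 * v.2, M 1 0 * v.1 + M 1 1 * v.2).

Lemma cross_lin v w : cross (lin v) (lin w) = \det M * cross v w.
Proof. by rewrite det_mx2 /cross /lin /=; ring. Qed.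

Lemma lin_dilate x v : lin (dilate x v) = dilate x (lin v).
Proof. by rewrite /lin /dilate /=; congr (_, _); ring. Qed.

Lemma lin_cayley_hamilton v :
  lin (lin v) = dilate (\tr M) (lin v) - dilate (\det M) v.
Proof. by rewrite tr_mx2 det_mx2 /lin /dilate; congr (_, _) => /=; ring. Qed.

Hypothesis detM : abs (\det M) = 1.

(** By Cayley-Hamilton, |M^(m+2) v| is at most the larger of |tr M| |M^(m+1) v| and |M^m v|, whence
    an induction on two consecutive bounds. It serves with [t = 1] for a small trace and with t =
    |tr M| against a contracted eigenvector. *)
Lemma iter_lin_bound (t : rat) v : 1 <= t -> abs (\tr M) <= t ->
  exists2 K, 0 <= K & forall m, sup_norm (iter m lin v) <= K * t ^+ m.
Proof.
move=> t1 Tt; set K := Num.max (sup_norm v) (sup_norm (lin v)).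
have K0 : 0 <= K by rewrite le_max sup_norm_ge0.
have t0 : 0 <= t by apply: le_trans t1.
exists K => // m.
suff /andP[] : (sup_norm (iter m lin v) <= K * t ^+ m)
  && (sup_norm (iter m.+1 lin v) <= K * t ^+ m.+1) by [].
elim: m => [|m /andP[IH0 IH1]].
  rewrite expr0 mulr1 expr1 le_max lexx /=.
  by apply: le_trans (ler_peMr K0 t1); rewrite le_max lexx orbT.
rewrite IH1 /= lin_cayley_hamilton.
apply: le_trans (sup_norm_ultra _ _) _; rewrite sup_normN !sup_norm_dilate detM mul1r.
rewrite ge_max; apply/andP; split.
  by rewrite exprS mulrCA ler_pM ?Qp_abs_ge0 ?sup_norm_ge0.
apply: le_trans IH0 _; rewrite ler_wpM2l // ler_weXn2l //.
by rewrite -addn2 leq_addr.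
Qed.

Lemma cross_iter_lin v w m :
  abs (cross (iter m lin v) (iter m lin w)) = abs (cross v w).
Proof. by elim: m => //= m <-; rewrite cross_lin Qp_absM detM mul1r. Qed.

(* Once the norm fails to decrease, the trace term of the Cayley-Hamilton
   recurrence dominates forever; and if it always decreases, it does so like
   |tr M|^-m, which forces the invariant |det(v, M v)| to vanish. *)
Lemma iter_lin_growth v : 1 < abs (\tr M) -> (forall m, iter m lin v != 0) ->
  (cross v (lin v) = 0 /\ sup_norm (lin v) < sup_norm v) \/
  (forall C, exists N, forall m, (N <= m)%N -> C < sup_norm (iter m lin v)).
Proof.
set t := abs (\tr M) => t1 v0; set x := fun m => iter m lin v.
have t0 : 0 < t by apply: lt_trans t1.
have x0 m : 0 < sup_norm (x m) by rewrite sup_norm_gt0; exact: v0.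
have [[m hm]|/forallNP dec] := pselect (exists m, sup_norm (x m) <= sup_norm (x m.+1)).
  right=> C; have grow i : sup_norm (x (m + i)%N) <= sup_norm (x (m + i).+1)
      /\ sup_norm (x (m + i).+1) = t ^+ i * sup_norm (x m.+1).
    elim: i => [|i [IH1 IH2]]; first by rewrite addn0 mul1r.
    have E : sup_norm (x (m + i).+2) = t * sup_norm (x (m + i).+1).
      rewrite {1}/x /= lin_cayley_hamilton -/(iter (m + i).+1 lin v).
      rewrite sup_norm_dominant sup_norm_dilate // sup_normN !sup_norm_dilate detM mul1r.
      by apply: le_lt_trans IH1 _; rewrite -[ltLHS]mul1r ltr_pM2r.
    rewrite addnS; split; first by rewrite E -[leLHS]mul1r ler_pM2r // ltW.
    by rewrite E IH2 exprS mulrA.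
  have [N hN] := expr_unbounded (C / sup_norm (x m.+1)) t1.
  exists (N + m.+1)%N => n Nn; have mn : (m.+1 <= n)%N by rewrite (leq_trans _ Nn) // leq_addl.
  rewrite -(subnKC mn) addSn -/(x _) (grow _).2 -ltr_pdivrMr // hN //.
  by rewrite leq_subRL // addnC.
have {}dec m : sup_norm (x m.+1) < sup_norm (x m) by rewrite ltNge; apply/negP/dec.
left; split; last exact: dec 0%N.
(* Solve the recurrence for the trace term: by strict decrease the determinant term outweighs
   x_{m+2}, so each step divides the norm by exactly [t]. *)
have xE m : t * sup_norm (x m.+1) = sup_norm (x m).
  rewrite -sup_norm_dilate; have -> : dilate (\tr M) (x m.+1) = dilate (\det M) (x m) + x m.+2.
    by rewrite {2}/x /= lin_cayley_hamilton addrC subrK.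
  have dx : sup_norm (dilate (\det M) (x m)) = sup_norm (x m).
    by rewrite sup_norm_dilate detM mul1r.
  by rewrite sup_norm_dominant // dx; apply: lt_trans (dec m); exact: dec.
have xtm m : t ^+ m * sup_norm (x m) = sup_norm v.
  by elim: m => [|m <-]; rewrite ?mul1r // -(xE m) exprSr mulrA.
apply/eqP; rewrite -Qp_abs_eq0; apply/eqP; set D := abs _.
have [//|D0] := eqVneq D 0; have {}D0 : 0 < D by rewrite lt_def D0 Qp_abs_ge0.
have [N /(_ N (leqnn N))] := expr_unbounded (sup_norm v * sup_norm v / D) t1.
rewrite ltr_pdivrMr // ltNge => /negP[].
rewrite -[in leRHS](xtm N) -[leRHS]mulrA ler_pM2l ?exprn_gt0 //.
rewrite /D -(cross_iter_lin _ _ N) -iterSr.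
apply: le_trans (cross_le _ _) _; rewrite ler_pM2l; last exact: x0.
rewrite xtm; elim: N.+1 => [|i IH]; first exact: lexx.
by apply: le_trans IH; apply: ltW; exact: dec.
Qed.

End Iteration.

(** * Continuant matrices and periodicity *)

Lemma mulmx2E (R : pzSemiRingType) (M N : 'M[R]_2) i j :
  (M *m N) i j = M i 0 * N 0 j + M i 1 * N 1 j.
Proof.
rewrite !mxE !big_ord_recl big_ord0 addr0.
by congr (_ + M _ _ * N _ _); apply: val_inj.
Qed.

Section ContinuantMatrix.
Variable F : fieldType.
Implicit Types (s t : seq F) (c : nat -> F).

Lemma cf_M_cat s t : cf_M (s ++ t) = cf_M s *m cf_M t.
Proof. exact: big_cat. Qed.

Lemma det_cf_M s : \det (cf_M s) = (-1) ^+ size s.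
Proof.
elim: s => [|x s IH]; first by rewrite /cf_M big_nil det1.
rewrite -cat1s cf_M_cat det_mulmx IH /cf_M big_seq1 det_mx2 !mxE /=.
by rewrite mulr0 mulr1 sub0r exprS.
Qed.

(** The case [n = 0], outside the range of [cf_ME], holds because the empty product has first column
    (1, 0). *)
Lemma cf_M_col c n : cf_M [seq c i | i <- iota 1 n] 0 0 = cf_A c n /\
  cf_M [seq c i | i <- iota 1 n] 1 0 = cf_B c n.
Proof.
case: n => [|n]; last by rewrite cf_ME !mxE.
by rewrite /cf_M big_nil !mxE.
Qed.

Lemma tr_cf_M c n : (0 < n)%N ->
  \tr (cf_M [seq c i | i <- iota 1 n]) = cf_A c n + cf_B c n.-1.
Proof. by case: n => // n _; rewrite tr_mx2 cf_ME !mxE. Qed.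

Lemma map_cf_M (K : fieldType) (f : {rmorphism F -> K}) s :
  map_mx f (cf_M s) = cf_M (map f s).
Proof.
elim: s => [|x s IH]; first by rewrite /cf_M !big_nil map_mx1.
have cons (K' : fieldType) (y : K') u : cf_M (y :: u) = cf_M [:: y] *m cf_M u.
  by rewrite /cf_M big_cons big_seq1.
rewrite map_cons (cons F x s) (cons K (f x)) map_mxM IH; congr (_ *m _).
rewrite /cf_M !big_seq1; apply/matrixP => i j; rewrite !mxE.
by case: i => [[|[|//]] ?]; case: j => [[|[|//]] ?] /=; rewrite ?rmorph0 ?rmorph1.
Qed.

Variables (c : nat -> F) (k : nat).
(** Periodicity starts at index 1: [c 0] is not a partial quotient, and under [cf_periodic] it need
    not equal [c k]. *)
Hypothesis c_per : forall n, c (n + k).+1 = c n.+1.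
Local Notation P n := (cf_M [seq c i | i <- iota 1 n]).
Local Notation Q n := (cf_M [seq c i | i <- iota n.+1 k]).

Lemma cf_M_shift n : P n *m Q n = P (n + k).
Proof. by rewrite iotaD map_cat cf_M_cat add1n. Qed.

Lemma cf_M_period n : P k *m P n = P (n + k).
Proof.
rewrite addnC iotaD map_cat cf_M_cat; congr (_ *m cf_M _).
rewrite addnC iotaDl -map_comp; apply/eq_in_map => -[|i]; rewrite mem_iota // => _ /=.
by rewrite addnC addSn c_per.
Qed.

(** The two factorizations of [P (n + k)] make [Q n] a conjugate of [P k] by [P n]. *)
Lemma tr_cf_M_shift n : \tr (Q n) = \tr (P k).
Proof.
have uP : P n \in unitmx by rewrite unitmxE det_cf_M unitrX // unitrN unitr1.
by rewrite -[Q n](mulKmx uP) cf_M_shift -cf_M_period mxtrace_mulC mulmxK.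
Qed.

End ContinuantMatrix.

Lemma map_cf_AB (F K : fieldType) (f : {rmorphism F -> K}) (c : nat -> F) n :
  cf_A (f \o c) n = f (cf_A c n) /\ cf_B (f \o c) n = f (cf_B c n).
Proof.
have [<- <-] := cf_M_col (f \o c) n; have [<- <-] := cf_M_col c n.
by rewrite (map_comp f c) -(map_cf_M f) !mxE.
Qed.

(** * Growth of the convergents of a periodic continued fraction *)

Section PeriodicConvergents.
Variables (p : nat) (c : nat -> Qp p) (k : nat).
Hypothesis c_per : forall n, c (n + k).+1 = c n.+1.
Local Notation abs := (@Qp_abs p).
Local Notation P n := (cf_M [seq c i | i <- iota 1 n]).
Local Notation Q n := (cf_M [seq c i | i <- iota n.+1 k]).
Local Notation v n := (cf_A c n, cf_B c n).

Lemma convergent_lin n : v (n + k) = lin (P k) (v n).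
Proof.
have [<- <-] := cf_M_col c (n + k); rewrite -cf_M_period // !mulmx2E /lin /=.
by have [-> ->] := cf_M_col c n.
Qed.

Lemma convergent_iter n m : v (n + m * k) = iter m (lin (P k)) (v n).
Proof.
elim: m => [|m IH]; first by rewrite addn0.
by rewrite mulSn addnCA addnC convergent_lin IH.
Qed.

(** The first column of [Q n] holds the coordinates of v_{n+k} in the basis formed by the columns of
    [P n], the first of which is v_n. *)
Lemma convergent_shift n : v (n + k) =
  (cf_A c n * Q n 0 0 + P n 0 1 * Q n 1 0, cf_B c n * Q n 0 0 + P n 1 1 * Q n 1 0).
Proof.
have [<- <-] := cf_M_col c (n + k); rewrite -cf_M_shift !mulmx2E.
by have [-> ->] := cf_M_col c n.
Qed.

(** Hence [Q n 1 0 = 0] exactly when v_n is an eigenvector of [P k]; the eigenvalue is then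
    [Q n 0 0]. *)
Lemma cross_convergent_shift n : cross (v n) (v (n + k)) = (-1) ^+ n * Q n 1 0.
Proof.
have := det_cf_M [seq c i | i <- iota 1 n]; rewrite size_map size_iota => <-.
rewrite convergent_shift det_mx2; have [-> ->] := cf_M_col c n.
by rewrite /cross /=; ring.
Qed.

Lemma convergent_eigen n : Q n 1 0 = 0 -> v (n + k) = dilate (Q n 0 0) (v n).
Proof. by move=> Q0; rewrite convergent_shift Q0 !mulr0 !addr0 /dilate /= ![Q n 0 0 * _]mulrC. Qed.

Lemma sup_norm_convergent_eigen n m : Q n 1 0 = 0 ->
  sup_norm (v (n + m * k)) = abs (Q n 0 0) ^+ m * sup_norm (v n).
Proof.
move=> Q0; rewrite convergent_iter -Qp_absX -sup_norm_dilate; congr sup_norm.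
elim: m => [|m /= ->]; first by rewrite /dilate !mul1r.
rewrite lin_dilate -convergent_lin convergent_eigen // /dilate /=.
by rewrite !mulrA -exprSr.
Qed.

Lemma cross_convergents n : abs (cross (v n) (v n.+1)) = 1.
Proof.
have E (x y x' y' : Qp p) : cross (x, y) (x', y') = - (x' * y - x * y').
  by rewrite /cross /=; ring.
by rewrite E cf_AB_det Qp_absN Qp_abs_sign.
Qed.

Lemma abs_det_cf_M (s : seq (Qp p)) : abs (\det (cf_M s)) = 1.
Proof. by rewrite det_cf_M Qp_abs_sign. Qed.

Hypothesis k_gt0 : (0 < k)%N.
(** This means tending to infinity, not merely being large along a subsequence. *)
Definition norm_products_unbounded : Prop := forall C, exists N, forall n, (N <= n)%N ->
  C < sup_norm (v n) * sup_norm (v n.+1).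

(** For a trace of absolute value at most 1, the orbits of v_0 and v_1 are bounded, hence so are the
    products at multiples of [k]. *)
Lemma unbounded_tr : norm_products_unbounded -> 1 < abs (\tr (P k)).
Proof.
move=> unb; rewrite ltNge; apply/negP => T1.
have bd := iter_lin_bound (abs_det_cf_M [seq c i | i <- iota 1 k]) _ (lexx 1) T1.
have [K K0 hK] := bd (v 0%N); have [L L0 hL] := bd (v 1%N).
have [N /(_ (N * k)%N (leq_pmulr N k_gt0))] := unb (K * L).
rewrite -(add0n (N * k)%N) convergent_iter -addSn convergent_iter.
rewrite ltNge => /negP[].
have := hK N; have := hL N; rewrite expr1n !mulr1 => h1 h2.
by rewrite ler_pM ?sup_norm_ge0.
Qed.

(** Otherwise |Q00| = 1 / |Q11| <= 1: each period multiplies |v_n| by |Q00|, while |v_{n+1}| grows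
    at most like the powers of |tr Q| = |Q11|, so the products stay bounded along n + m k. *)
Lemma unbounded_not_contracting n : norm_products_unbounded ->
  Q n 1 0 = 0 -> abs (Q n 1 1) < 1.
Proof.
move=> unb Q0; have := unbounded_tr unb; rewrite -(tr_cf_M_shift c_per n) => T1.
rewrite ltNge; apply/negP => Q11.
have detQ : abs (Q n 0 0) * abs (Q n 1 1) = 1.
  rewrite -Qp_absM -(abs_det_cf_M [seq c i | i <- iota n.+1 k]) det_mx2.
  by rewrite Q0 mulr0 subr0.
have Q00 : abs (Q n 0 0) <= 1.
  by rewrite -[leRHS]detQ ler_peMr ?Qp_abs_ge0.
have TQ : abs (\tr (Q n)) = abs (Q n 1 1).
  move: T1; rewrite tr_mx2 => T1; rewrite addrC Qp_abs_dominant //.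
  apply: (le_lt_trans Q00); rewrite ltNge; apply/negP => Q11'.
  by move: T1; rewrite ltNge (le_trans (Qp_abs_ultra _ _)) // ge_max Q00.
have [||K K0 hK] := iter_lin_bound (abs_det_cf_M [seq c i | i <- iota 1 k])
    (t := abs (Q n 1 1)) (v n.+1); first exact: Q11.
  by rewrite -(tr_cf_M_shift c_per n) TQ.
have [N /(_ (n + N * k)%N)] := unb (sup_norm (v n) * K).
rewrite (sup_norm_convergent_eigen _ Q0) -addSn convergent_iter ltNge => h.
case/negP: (h (leq_trans (leq_pmulr N k_gt0) (leq_addl _ _))).
apply: le_trans (ler_wpM2l _ (hK N)) _.
  by rewrite mulr_ge0 ?exprn_ge0 ?Qp_abs_ge0 ?sup_norm_ge0.
have -> : abs (Q n 0 0) ^+ N * sup_norm (v n) * (K * abs (Q n 1 1) ^+ N)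
  = (abs (Q n 0 0) ^+ N * abs (Q n 1 1) ^+ N) * (sup_norm (v n) * K) by ring.
by rewrite -exprMn detQ expr1n mul1r.
Qed.

(** Each residue class modulo [k] is one orbit of [P k]. In the contracting alternative of
    [iter_lin_growth], [Q r 1 0 = 0] and |Q00| < 1, which together with |Q11| < 1 contradicts |det
    Q| = 1. *)
Lemma not_contracting_unbounded : 1 < abs (\tr (P k)) ->
    (forall n, (n < k)%N -> Q n 1 0 = 0 -> abs (Q n 1 1) < 1) ->
  norm_products_unbounded.
Proof.
move=> T1 hQ.
have growth r : (r < k)%N -> forall C, exists N, forall m, (N <= m)%N ->
    C < sup_norm (v (r + m * k)).
  move=> rk C.
  have v0 m : iter m (lin (P k)) (v r) != 0 by rewrite -convergent_iter cf_AB_neq0.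
  have [[]|/(_ C)[N hN]] := iter_lin_growth (abs_det_cf_M _) T1 v0; last first.
    by exists N => m /hN; rewrite convergent_iter.
  rewrite -convergent_lin => /eqP.
  rewrite cross_convergent_shift mulf_eq0 signr_eq0 /= => /eqP Q0.
  have v_gt0 : 0 < sup_norm (v r) by rewrite sup_norm_gt0 cf_AB_neq0.
  rewrite convergent_eigen // sup_norm_dilate -[ltRHS]mul1r ltr_pM2r // => Q00.
  have := abs_det_cf_M [seq c i | i <- iota r.+1 k].
  rewrite det_mx2 Q0 mulr0 subr0 Qp_absM => /eqP.
  have Q11 := hQ r rk Q0; rewrite lt_eqF //.
  by rewrite -[ltRHS]mul1r ltr_pM ?Qp_abs_ge0.
(* A lower bound that is at least 1 and exceeds |C| passes from the two factors to their product;
   the threshold is the maximum over the finitely many residues. *)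
move=> C; have D1 : 1 <= `|C| + 1 by rewrite lerDr.
have /(_ _)/cid-/all_sig[N hN] (r : 'I_k) := growth r (ltn_ord r) (`|C| + 1).
pose N1 := (\max_r N r)%N.
have big n : (N1 * k <= n)%N -> `|C| + 1 < sup_norm (v n).
  move=> Nn; rewrite (divn_eq n k) addnC.
  apply: (hN (Ordinal (ltn_pmod n k_gt0))) => /=.
  apply: (@leq_trans N1); first exact: leq_bigmax.
  by rewrite leq_divRL.
exists (N1 * k)%N => n Nn; apply: le_lt_trans (ler_norm C) _.
apply: (@lt_trans _ _ (`|C| + 1)); first by rewrite ltrDl.
apply: (lt_trans (big n Nn)); rewrite -[ltLHS]mulr1 ltr_pM2l.
  by apply: le_lt_trans D1 _; apply: big; exact: leqW.
by rewrite sup_norm_gt0 cf_AB_neq0.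
Qed.

End PeriodicConvergents.

Theorem theorem3p1 (p k : nat) (a : k.-tuple rat)
    (p_prime : prime p) (p_odd : odd p) (k_gt0 : (0 < k)%N)
    (a_Zinv : forall i : 'I_k, in_Zinv p (tnth a i)) :
  let c := cf_periodic a in
  cf_converges (fun n => Qp_of_rat p (c n)) <->
  (1 < padic_abs p (cf_A c k + cf_B c k.-1) /\
   forall j : nat, (1 <= j <= k)%N ->
     let M := cf_M [seq c i | i <- iota j k] in
     M 1 0 = 0 -> padic_abs p (M 1 1) < 1).
Proof.
move=> c; pose c' n := Qp_of_rat p (c n).
have c_per n : c' (n + k).+1 = c' n.+1 by rewrite /c' /c /cf_periodic /= modnDr.
(* The conditions live over [rat] and convergence over Q_p; the embedding commutes with continuants,
   is injective and preserves absolute values. *)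
have A' n : cf_A c' n = Qp_of_rat p (cf_A c n).
  exact: (map_cf_AB (Qp_of_rat p) c n).1.
have B' n : cf_B c' n = Qp_of_rat p (cf_B c n).
  exact: (map_cf_AB (Qp_of_rat p) c n).2.
have M' j i l : cf_M [seq c' i | i <- iota j k] i l
    = Qp_of_rat p (cf_M [seq c i | i <- iota j k] i l).
  by rewrite [map c' _](map_comp (Qp_of_rat p) c) -(map_cf_M (Qp_of_rat p)) mxE.
have M0 j : cf_M [seq c' i | i <- iota j k] 1 0 = 0
    <-> cf_M [seq c i | i <- iota j k] 1 0 = 0.
  by rewrite M'; split=> [/eqP|->]; rewrite ?fmorph_eq0 ?rmorph0 // => /eqP.
have T' : padic_abs p (cf_A c k + cf_B c k.-1)
    = Qp_abs (\tr (cf_M [seq c' i | i <- iota 1 k])).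
  by rewrite tr_cf_M // A' B' -rmorphD Qp_abs_rat.
have cvgE : cf_converges c' <-> forall C, exists N, forall n, (N <= n)%N ->
    C < sup_norm (cf_A c' n, cf_B c' n) * sup_norm (cf_A c' n.+1, cf_B c' n.+1).
  exact: P1_cvg_iff A' B' (cross_convergents c').
rewrite T'; split=> [/cvgE unb|[T1 hM]].
  split=> [|[//|n] _ /= /M0 Q0]; first exact: unbounded_tr unb.
  by rewrite -Qp_abs_rat -M'; exact: unbounded_not_contracting unb Q0.
apply/cvgE; apply: not_contracting_unbounded => // n nk /M0 Q0.
by rewrite M' Qp_abs_rat hM.
Qed.
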